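(* Let $F$ be a finitely generated non-abelian free group with finite basis $A$. For every multi-cylinder $C^1_U$, determined by a finite set $U\subset F(A)$, there is a unique finite subset $U_{\min}\subset F(A)$ of minimal cardinality which determines the same multi-cylinder: $$C^1_{U_{\min}}=C^1_U .$$ The set $U_{\min}$ can be derived algorithmically from $U$ by a finite sequence of elementary operations (of types (1) and (2)), each of which strictly decreases the cardinality.
   Context: $F(A)$ denotes the set of finite reduced words in $A\cup A^{-1}$, identified with $F$; $|w|$ is word length. $\partial F(A)$ is the set of infinite reduced words in $A\cup A^{-1}$. For $u\in F(A)$ the cylinder $C^1_u\subset\partial F(A)$ is the set of all infinite reduced words having $u$ as prefix. For a finite set $U\subset F(A)$ the multi-cylinder is $C^1_U=\bigcup_{u\in U}C^1_u$. For $v,w\in F(A)$ write $v<w$ if $v$ is a prefix of $w$ and $|v|<|w|$. For $u\in F(A)$, $u|^1$ is the set of reduced words obtained from $u$ by adding one letter from $A\cup A^{-1}$ at the end. Elementary operations on a finite set $U_1\subset F(A)$, producing $U_2$: Type (1): if there are $u_i,u_j\in U_1$ with $u_i<u_j$, let $U_2=U_1\smallsetminus\{u_j\}$. Type (2): if there is $u\in F(A)\smallsetminus U_1$ with $u|^1\subset U_1$, let $U_2=(U_1\smallsetminus u|^1)\cup\{u\}$. *)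

(* Defs.v *)
From HB Require Import structures.
From mathcomp Require Import all_boot finmap.
From mathcomp Require Import boolp classical_sets.

Set Implicit Arguments.
Unset Strict Implicit.
Unset Printing Implicit Defensive.

Local Open Scope fset_scope.

Section Words.
Variable A : finType.

(* (a, false) stands for the letter a, and (a, true) for its inverse. *)
Definition letter : Type := (A * bool)%type.

Definition inv_letter (l : letter) : letter := (l.1, ~~ l.2).

Definition no_cancel : rel letter := fun l m => m != inv_letter l.

(* The elements of F(A). *)
Record rword := RWord {
  rword_seq :> seq letter;
  rword_reduced : sorted no_cancel rword_seq }.

HB.instance Definition _ := [isSub for rword_seq].
HB.instance Definition _ := [Choice of rword by <:].

(* The elements of the boundary of F(A). *)
Record iword := IWord {
  iword_fun :> nat -> letter;
  iword_reduced : forall n, no_cancel (iword_fun n) (iword_fun n.+1) }.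

Definition cylinder (u : rword) : set iword :=
  [set x : iword | mkseq x (size u) = u :> seq letter]%classic.

Definition multi_cylinder (U : {fset rword}) : set iword :=
  (\bigcup_(u in [set` U]) cylinder u)%classic.

Definition proper_prefix : rel rword :=
  fun v w => prefix v w && (size v < size w).

(* The set u|^1; [insub] discards the letter that would cancel the last letter
   of u. *)
Definition one_letter_ext (u : rword) : {fset rword} :=
  [fset w in pmap insub [seq rcons u l | l <- enum {: letter}]].

Definition elementary1 (U1 U2 : {fset rword}) : Prop :=
  exists ui uj : rword,
    [/\ ui \in U1, uj \in U1, proper_prefix ui uj & U2 = U1 `\ uj].

Definition elementary2 (U1 U2 : {fset rword}) : Prop :=
  exists u : rword,
    [/\ u \notin U1, one_letter_ext u `<=` U1
      & U2 = (U1 `\` one_letter_ext u) `|` [fset u]].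

Definition elementary (U1 U2 : {fset rword}) : Prop :=
  elementary1 U1 U2 \/ elementary2 U1 U2.

Fixpoint decreasing_elementary_chain
    (U : {fset rword}) (s : seq {fset rword}) : Prop :=
  if s is V :: s' then
    [/\ elementary U V, #|` V| < #|` U| & decreasing_elementary_chain V s']
  else True.

Definition minimal_determining (U V : {fset rword}) : Prop :=
  multi_cylinder V = multi_cylinder U /\
  forall W : {fset rword},
    multi_cylinder W = multi_cylinder U -> #|` V| <= #|` W|.

(* The algorithm: perform elementary operations, found by exhaustive search, as
   long as one is applicable.  It is an explicit program so that the
   derivability of U_min by an algorithm is not a mere existence statement.
   For operations of type (2), if u|^1 is a nonempty subset of U then u is
   obtained from an element of U by deleting the last letter, so that it is
   enough to try these words. *)

Definition drop_last (w : rword) : rword :=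
  RWord (take_sorted (size w).-1 (rword_reduced w)).

Definition results1 (U : {fset rword}) : seq {fset rword} :=
  [seq U `\ w | w <- enum_fset U & has (fun v => proper_prefix v w) (enum_fset U)].

Definition results2 (U : {fset rword}) : seq {fset rword} :=
  [seq (U `\` one_letter_ext u) `|` [fset u]
    | u <- [seq drop_last w | w <- enum_fset U]
    & (u \notin U) && (one_letter_ext u `<=` U)].

Definition next (U : {fset rword}) : option {fset rword} :=
  ohead (results1 U ++ results2 U).

Fixpoint run (fuel : nat) (U : {fset rword}) : seq {fset rword} :=
  if fuel is n.+1 then
    if next U is Some V then V :: run n V else [::]
  else [::].

(* The sets obtained successively from U.  Each operation removes at least one
   element, hence no more than #|` U| operations are possible. *)
Definition reduction (U : {fset rword}) : seq {fset rword} := run #|` U| U.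

End Words.

Section Basis.
Variables (F : groupType) (A : {fset F}).

Definition letter_value (l : letter A) : F :=
  if l.2 then ((val l.1)^-1)%g else val l.1.

Definition word_value (w : rword A) : F :=
  foldr (fun l x => (letter_value l * x)%g) 1%g w.

(* F is free with basis A: F is identified with F(A). *)
Definition is_basis : Prop :=
  forall x : F, exists! w : rword A, word_value w = x.

End Basis.

(* Main.v *)
(** Call a finite set [U] irreducible if no elementary operation applies to it.
    If [U] is irreducible and [C_v] is contained in [C_U], then some prefix of
    [v] belongs to [U]: otherwise, as type (2) does not apply at [v], some
    extension of [v] by one letter has the same property, and so on beyond the
    length of every word of [U], which is absurd since cylinders are nonempty.
    Hence two irreducible sets with the same multi-cylinder consist of prefixes
    of each other's elements and, being antichains by type (1), coincide.
    As every operation decreases the cardinality (for type (2) because [u|^1]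
    has at least two elements, the rank being at least two) and preserves the
    multi-cylinder, the reduction of any set ends in the irreducible set of its
    multi-cylinder. *)
Require Import Defs.
From mathcomp Require Import all_boot finmap.
From mathcomp Require Import boolp classical_sets.

Set Implicit Arguments.
Unset Strict Implicit.
Unset Printing Implicit Defensive.

Local Open Scope fset_scope.

(** * Reduced words and their one-letter extensions *)

Lemma mem_one_letter_ext (A : finType) (u w : rword A) :
  (w \in one_letter_ext u) <-> exists l, w = rcons u l :> seq (letter A).
Proof.
rewrite /one_letter_ext in_fset /= mem_pmap; split.
  case/mapP => _ /mapP[l _ ->] h; exists l; move: h.
  by case: insubP => // v _ <- [->].
case=> l wE; apply/mapP; exists (rcons u l).
  by apply: map_f; rewrite mem_enum.
by rewrite -wE (valK w).
Qed.

(** Cancelling letters have opposite signs, so every generator may be appended with the sign of the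
    last letter. Two generators thus yield two extensions of [u]. *)
Lemma rcons_same_sign_reduced (A : finType) (u : rword A) (a : A) :
  sorted (@no_cancel A) (rcons u (a, (last (a, true) u).2)).
Proof.
case: u => -[//|m s] red; rewrite /= rcons_path; apply/andP; split=> //.
by rewrite /no_cancel /inv_letter /=; case: (last m s) => b []; apply/eqP => -[].
Qed.

Lemma card_one_letter_ext (A : finType) (A_gt1 : 1 < #|A|) (u : rword A) :
  1 < #|` one_letter_ext u|.
Proof.
have [a [b [_ _ ab]]] := card_gt1P A_gt1.
pose ext c := RWord (rcons_same_sign_reduced u c).
have ext_in c : ext c \in one_letter_ext u.
  by apply/mem_one_letter_ext; exists (c, (last (c, true) u).2).
have ext_neq : ext a != ext b.
  apply: contra ab => /eqP /(congr1 (@rword_seq A)) /= /rcons_inj.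
  by move/(congr1 (fun p => p.2.1)) => /= ->.
have /fsubset_leq_card : [fset ext a; ext b] `<=` one_letter_ext u.
  by apply/fsubsetP => w; rewrite in_fset2 => /orP[] /eqP ->.
by rewrite cardfs2 ext_neq.
Qed.

Lemma prefix_eq_size (A : finType) (u v : rword A) :
  prefix u v -> size v <= size u -> u = v.
Proof.
rewrite prefixE => /eqP uE vu.
by apply/val_inj; rewrite /= -uE take_oversize.
Qed.

(** * Cylinders of infinite reduced words *)

Lemma take_mkseq (T : Type) (f : nat -> T) m n :
  m <= n -> take m (mkseq f n) = mkseq f m.
Proof. by move=> mn; rewrite /mkseq -map_take take_iota (minn_idPl mn). Qed.

Lemma mkseqSr (T : Type) (f : nat -> T) n :
  mkseq f n.+1 = rcons (mkseq f n) (f n).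
Proof. by rewrite /mkseq -addn1 iotaD map_cat cats1. Qed.

Lemma mkseq_reduced (A : finType) (x : iword A) n :
  sorted (@no_cancel A) (mkseq x n).
Proof.
case: n => // n; apply/(sortedP (x 0)) => i; rewrite size_mkseq => lt_in.
by rewrite (nth_mkseq _ _ lt_in) (nth_mkseq _ _ (ltnW lt_in)) iword_reduced.
Qed.

Lemma cylinder_nonempty (A : finType) (a : A) (u : rword A) :
  exists x, cylinder u x.
Proof.
(* As default of [nth], [l] continues [u] by repeating its last letter, which never cancels itself;
   an empty [u] is continued by [(a, true)]. *)
pose l : letter A := last (a, true) u.
pose f n := nth l u n.
have letter_red (m : letter A) : no_cancel m m.
  by case: m => b []; apply/eqP => -[].
have f_red n : no_cancel (f n) (f n.+1).
  rewrite /f; have [lt_nu|] := ltnP n.+1 (size u).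
    by have /sortedP := rword_reduced u; apply.
  (* If [size u = n.+1], the last letter of [u] meets the first default letter. *)
  rewrite leq_eqVlt => /orP[/eqP sz|lt_un].
    rewrite (nth_default _ (n := n.+1)) ?sz //.
    have -> : nth l u n = l.
      by rewrite -[n]/n.+1.-1 -sz nth_last /l; case: (u : seq _) sz.
    exact: letter_red.
  by rewrite (nth_default _ lt_un) (nth_default _ (ltnW lt_un)).
by exists (IWord f_red); rewrite /cylinder /= /f mkseq_nth.
Qed.

Lemma cylinder_prefix (A : finType) (u v : rword A) :
  prefix u v -> (cylinder v `<=` cylinder u)%classic.
Proof.
move=> uv x; rewrite /cylinder /= => xv.
by rewrite -(take_mkseq x (size_prefix uv)) xv; apply/eqP; rewrite -prefixE.
Qed.

Lemma cylinders_meet (A : finType) (u v : rword A) (x : iword A) :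
  cylinder u x -> cylinder v x -> size u <= size v -> prefix u v.
Proof.
by rewrite /cylinder /= prefixE => xu xv uv; rewrite -xv take_mkseq ?xu.
Qed.

Lemma cylinder_one_letter_ext (A : finType) (u : rword A) :
  cylinder u = multi_cylinder (one_letter_ext u).
Proof.
apply/seteqP; split => x.
  move=> xu; exists (RWord (mkseq_reduced x (size u).+1)).
    by apply/mem_one_letter_ext; exists (x (size u)); rewrite /= mkseqSr xu.
  by rewrite /cylinder /= size_map size_iota.
case=> w /mem_one_letter_ext[l wE]; apply: cylinder_prefix.
by rewrite wE prefix_rcons.
Qed.

Lemma multi_cylinderS (A : finType) (U V : {fset rword A}) :
  U `<=` V -> (multi_cylinder U `<=` multi_cylinder V)%classic.
Proof. by move=> /fsubsetP UV x [u /UV uV xu]; exists u. Qed.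

Lemma multi_cylinderU (A : finType) (U V : {fset rword A}) :
  multi_cylinder (U `|` V) = (multi_cylinder U `|` multi_cylinder V)%classic.
Proof. by rewrite /multi_cylinder set_fsetU bigcup_setU. Qed.

Lemma multi_cylinder1 (A : finType) (u : rword A) :
  multi_cylinder [fset u] = cylinder u.
Proof. by rewrite /multi_cylinder set_fset1 bigcup_set1. Qed.

(** * Effect of the elementary operations *)

Lemma elementary_multi_cylinder (A : finType) (U V : {fset rword A}) :
  elementary U V -> multi_cylinder V = multi_cylinder U.
Proof.
case=> [[v [w [vU wU /andP[vw lt_vw] ->]]]|[u [_ uU ->]]].
  rewrite -[in RHS](fsetD1K wU) multi_cylinderU multi_cylinder1.
  apply/esym/setUidPr/(subset_trans (cylinder_prefix vw)).
  rewrite -multi_cylinder1; apply: multi_cylinderS.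
  (* Being strictly shorter than [w], the word [v] survives the removal. *)
  rewrite fsub1set !inE vU andbT; apply: contraTneq lt_vw => ->.
  by rewrite ltnn.
rewrite multi_cylinderU multi_cylinder1 cylinder_one_letter_ext.
by rewrite -multi_cylinderU fsetUC -{1}(fsetIidPr uU) fsetID.
Qed.

Lemma elementary_card (A : finType) (A_gt1 : 1 < #|A|) (U V : {fset rword A}) :
  elementary U V -> #|` V| < #|` U|.
Proof.
case=> [[v [w [_ wU _ ->]]]|[u [_ uU ->]]].
  by rewrite (cardfsD1 w U) wU.
apply: (leq_ltn_trans (leq_card_fsetU _ _)).
rewrite cardfs1 cardfsD (fsetIidPr uU).
rewrite -[ltnRHS](subnK (fsubset_leq_card uU)) ltn_add2l.
exact: card_one_letter_ext.
Qed.

(** * Irreducible sets *)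

Definition irreducible (A : finType) (U : {fset rword A}) : Prop :=
  forall V, ~ elementary U V.

Lemma irreducible_prefix (A : finType) (a : A) (U : {fset rword A}) (v : rword A) :
  irreducible U -> (cylinder v `<=` multi_cylinder U)%classic ->
  exists2 u, u \in U & prefix u v.
Proof.
move=> irrU; pose N := \max_(u <- enum_fset U) size u.
have le_N u : u \in U -> size u <= N.
  by move=> uU; exact: (leq_bigmax_seq u).
have [n] := ubnP (N.+1 - size v); elim: n v => // n IHn v le_n vU.
(* The goal stays the same, but its negation becomes available. *)
apply: contrapT => noprefix; apply/noprefix.
have [lt_Nv|le_vN] := ltnP N (size v).
  have [x xv] := cylinder_nonempty a v; have [u uU xu] := vU x xv.
  exists u => //; apply: (cylinders_meet xu xv).
  by rewrite ltnW // (leq_ltn_trans (le_N u uU)).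
have vNU : v \notin U.
  by apply/negP => h; apply: noprefix; exists v => //; apply: prefix_refl.
have /fsubsetPn[w wv wU] : ~~ (one_letter_ext v `<=` U).
  apply/negP => h; apply: (irrU (U `\` one_letter_ext v `|` [fset v])).
  by right; exists v.
have [l wE] : exists l, w = rcons v l :> seq _ by apply/mem_one_letter_ext.
have vw : prefix v w by rewrite wE prefix_rcons.
have [||u uU uw] := IHn w.
- by rewrite wE size_rcons subSS -ltnS -subSn.
- exact: subset_trans (cylinder_prefix vw) vU.
(* A prefix of [w] is either a prefix of [v] or [w] itself, and [w] is not in [U]. *)
exists u => //; have [le_uv|lt_vu] := leqP (size u) (size v).
  have [x xw] := cylinder_nonempty a w.
  exact: cylinders_meet (cylinder_prefix uw xw) (cylinder_prefix vw xw) le_uv.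
case/negP: wU; rewrite -(prefix_eq_size uw) //.
by rewrite wE size_rcons.
Qed.

(** Each [u] in [U] has a prefix [v] in [V], which has a prefix [u'] in [U]. Type (1) forbids [u']
    to be shorter than [u], which forces [v = u]. *)
Lemma irreducible_sub (A : finType) (a : A) (U V : {fset rword A}) :
  irreducible U -> irreducible V -> multi_cylinder U = multi_cylinder V ->
  U `<=` V.
Proof.
have cyl_sub (W : {fset rword A}) w :
    w \in W -> (cylinder w `<=` multi_cylinder W)%classic.
  by move=> wW x xw; exists w.
move=> irrU irrV UV; apply/fsubsetP => u uU.
have [|v vV vu] := irreducible_prefix a irrV (v := u).
  by rewrite -UV; apply: cyl_sub.
have [|u' u'U u'v] := irreducible_prefix a irrU (v := v).
  by rewrite UV; apply: cyl_sub.
have [lt_u'u|le_uu'] := ltnP (size u') (size u).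
  case: (irrU (U `\ u)); left; exists u', u; split => //.
  by rewrite /proper_prefix (prefix_trans u'v vu).
suff <- : v = u by [].
exact/(prefix_eq_size vu)/(leq_trans le_uu')/size_prefix.
Qed.

(** * Correctness of the algorithm *)

Lemma mem_results1 (A : finType) (U V : {fset rword A}) :
  V \in results1 U <-> elementary1 U V.
Proof.
split.
  case/mapP => w; rewrite mem_filter => /andP[/hasP[v vU vw] wU] ->.
  by exists v, w.
case=> v [w [vU wU vw ->]]; apply/mapP; exists w => //.
by rewrite mem_filter wU andbT; apply/hasP; exists v.
Qed.

(** The search is exhaustive because $u|^1$ is nonempty: dropping the last letter of any of its
    words gives back [u]. *)
Lemma mem_results2 (A : finType) (A_gt1 : 1 < #|A|) (U V : {fset rword A}) :
  V \in results2 U <-> elementary2 U V.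
Proof.
split.
  by case/mapP => u; rewrite mem_filter => /andP[/andP[uU extU] _] ->; exists u.
case=> u [uU extU ->]; apply/mapP; exists u => //.
rewrite mem_filter uU extU /=.
have := ltnW (card_one_letter_ext A_gt1 u).
rewrite cardfs_gt0 => /fset0Pn[w w_ext].
apply/mapP; exists w; first exact: (fsubsetP extU).
case/mem_one_letter_ext: w_ext => l wE.
by apply/val_inj; rewrite /= wE size_rcons -cats1 take_size_cat.
Qed.

Lemma next_Some (A : finType) (A_gt1 : 1 < #|A|) (U V : {fset rword A}) :
  Defs.next U = Some V -> elementary U V.
Proof.
rewrite /Defs.next; case E: (_ ++ _) => [//|W s] [<-].
have : W \in results1 U ++ results2 U by rewrite E mem_head.
by rewrite mem_cat => /orP[/mem_results1|/(mem_results2 A_gt1)]; [left|right].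
Qed.

Lemma next_None (A : finType) (A_gt1 : 1 < #|A|) (U : {fset rword A}) :
  Defs.next U = None -> irreducible U.
Proof.
rewrite /Defs.next; case E: (_ ++ _) => // _ V UV.
suff : V \in results1 U ++ results2 U by rewrite E.
rewrite mem_cat.
by case: UV => [/mem_results1 ->|/(mem_results2 A_gt1) ->]; rewrite ?orbT.
Qed.

(** The equality case in the last clause serves uniqueness: a set whose reduction has the same
    cardinality admits no operation. *)
Lemma run_spec (A : finType) (A_gt1 : 1 < #|A|) n (U : {fset rword A}) :
  #|` U| <= n ->
  [/\ decreasing_elementary_chain U (run n U), irreducible (last U (run n U)),
      multi_cylinder (last U (run n U)) = multi_cylinder U
    & #|` last U (run n U)| <= #|` U| ?= iff (Defs.next U == None)].
Proof.
elim: n U => [|n IHn] U le_Un /=; case E: (Defs.next U) => [V|] /=.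
(* Without fuel [U] is empty, so its cardinality cannot decrease. *)
- by have /(elementary_card A_gt1)/leq_trans/(_ le_Un) := next_Some A_gt1 E.
- by split=> //; [exact: next_None | rewrite eqxx; apply/leqif_refl].
- have UV := next_Some A_gt1 E; have lt_VU := elementary_card A_gt1 UV.
  have [|chainV irr eqC [le_V _]] := IHn V; first by rewrite -ltnS (leq_trans lt_VU).
  split=> //; first by rewrite eqC; apply: elementary_multi_cylinder.
  have lt := leq_ltn_trans le_V lt_VU.
  by split; [exact: ltnW | rewrite ltn_eqF].
- by split=> //; [exact: next_None | rewrite eqxx; apply/leqif_refl].
Qed.

Lemma reduction_minimal (A : finType) (A_gt1 : 1 < #|A|) (U : {fset rword A}) :
  unique (minimal_determining U) (last U (reduction U)).
Proof.
have [_ irrU UC _] := run_spec A_gt1 (leqnn #|` U|).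
have [a _] : exists a : A, a \in A by apply/card_gt0P/ltnW.
have last_eq W : multi_cylinder W = multi_cylinder U ->
    last W (reduction W) = last U (reduction U).
  move=> WU; have [_ irrW WC _] := run_spec A_gt1 (leqnn #|` W|).
  apply/eqP; rewrite eqEfsubset.
  by apply/andP; split; apply: (irreducible_sub a) => //; rewrite WC UC.
have last_le W : multi_cylinder W = multi_cylinder U ->
    #|` last U (reduction U)| <= #|` W| ?= iff (Defs.next W == None).
  by move=> WU; rewrite -(last_eq W WU); case: (run_spec A_gt1 (leqnn #|` W|)).
split; first by split=> // W /last_le[].
(* A minimal [V] is as large as its reduction, hence admits no operation and is its own
   reduction. *)
move=> V [VU Vmin]; have [le_V /esym] := last_le V VU.
rewrite eqn_leq le_V Vmin // => /eqP nextV.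
by rewrite -(last_eq V VU) /reduction; case: #|` V| => //= k; rewrite nextV.
Qed.

(** * Rank of a non-abelian free group *)

Local Open Scope group_scope.

(** With at most one generator all letters have commuting values, hence so do all words, and these
    represent every element of [F]. *)
Lemma nonabelian_basis_card (F : groupType) (A : {fset F}) :
  is_basis A -> ~ (forall x y : F, x * y = y * x) -> 1 < #|{: A}|.
Proof.
move=> basisA nonab; rewrite ltnNge; apply/negP => card_le1; apply: nonab.
have letterC (l m : letter A) : commute (letter_value l) (letter_value m).
  rewrite /letter_value (card_le1_eqP card_le1 l.1 m.1) //.
  have c1 := commute_refl (val l.1); have cV := commuteV c1.
  by case: l.2; case: m.2 => //; apply: commute_sym.
have wordC x (w : rword A) :
    (forall l : letter A, commute x (letter_value l)) -> commute x (word_value w).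
  move=> xC; rewrite /word_value; elim: (w : seq _) => [|l s IHs] /=.
    exact: commute1.
  exact: commuteM.
move=> x y; have [[v [<- _]] [w [<- _]]] := (basisA x, basisA y).
by apply: (wordC _) => l; apply/commute_sym/(wordC _) => m.
Qed.

Theorem proposition1p3 (F : groupType) (A : {fset F})
    (A_basis : is_basis A)
    (F_nonabelian : ~ (forall x y : F, (x * y)%g = (y * x)%g))
    (U : {fset rword A}) :
  exists Umin : {fset rword A},
    unique (minimal_determining U) Umin /\
    (decreasing_elementary_chain U (reduction U) /\
     last U (reduction U) = Umin).
Proof.
have A_gt1 := nonabelian_basis_card A_basis F_nonabelian.
exists (last U (reduction U)); split; first exact: reduction_minimal.
by split=> //; have [] := run_spec A_gt1 (leqnn #|` U|).
Qed.
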